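(* Suppose that $\mu_{\widehat{F}}>0$. Let $x^\star$ be the unique minimizer of $\Psi$. Let $\kappa\in(0,1)$ and $\gamma_0\in(0,2(1-\kappa)/L_{\widehat{F}})$. Set $\gamma_1=\gamma_0$ and $$\gamma_{k+1}=-\gamma_k^2\mu_{\widehat{F}}\kappa+\gamma_k\sqrt{(\gamma_k\mu_{\widehat{F}}\kappa)^2+1},\quad\text{for every }k\geq1.$$ Suppose that $\eta\geq\|\widehat{K}\|^2$, where $\|\widehat{K}\|^2=\max_{m=1,\ldots,M}\|K_m\|^2$ or, in the case $F_m\equiv0$ for all $m$, $\|\widehat{K}\|^2=\big\|\sum_{m=1}^M\omega_mK_m^*K_m\big\|$. Then in the Distributed PDDY Algorithm with these stepsizes, there exists $\hat{c}_0>0$ such that, for every $k\geq1$, $$\sum_{m=1}^M\omega_m\|x_m^{k+1}-x^\star\|^2\leq\frac{\gamma_{k+1}^2}{1-\gamma_{k+1}\mu_{\widehat{F}}\kappa}\,\hat{c}_0=O\big(1/k^2\big).$$ Consequently, for every $m=1,\ldots,M$, $\|x_m^k-x^\star\|^2=O(1/k^2)$. Moreover, if $\eta>\|\widehat{K}\|^2$, then $\|x_R^k-x^\star\|^2=O(1/k^2)$ as well.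
   Context: Let $M\geq1$. $\mathcal{X}$ and $\mathcal{U}_1,\ldots,\mathcal{U}_M$ are finite-dimensional real Hilbert spaces; $K_m:\mathcal{X}\to\mathcal{U}_m$ are linear operators with adjoints $K_m^*$; $R:\mathcal{X}\to\mathbb{R}\cup\{+\infty\}$ and $H_m:\mathcal{U}_m\to\mathbb{R}\cup\{+\infty\}$ are proper, closed, convex; $F_m:\mathcal{X}\to\mathbb{R}$ are convex and $L_{F_m}$-smooth, $L_{F_m}>0$ (differentiable with $L_{F_m}$-Lipschitz gradient), and $\mu_{F_m}\geq0$ is some constant such that $F_m-\frac{\mu_{F_m}}{2}\|\cdot\|^2$ is convex. Set $$\Psi(x)=\frac1M\sum_{m=1}^M\big(F_m(x)+H_m(K_mx)\big)+R(x).$$ $(\omega_m)_{m=1}^M$ are positive weights with $\sum_m\omega_m=1$. $G^*$ denotes the convex conjugate of $G$ and $\mathrm{prox}_G(z)=\arg\min_{z'}\{G(z')+\frac12\|z-z'\|^2\}$. Constants: $L_{\widehat{F}}=\max_{m}\frac{L_{F_m}}{M\omega_m}$ and $\mu_{\widehat{F}}=\min_m\frac{\mu_{F_m}}{M\omega_m}$. Standing assumption: there exists $x^\star\in\mathcal{X}$ with $0\in\frac1M\sum_{m=1}^M\big(\nabla F_m(x^\star)+K_m^*\partial H_m(K_mx^\star)\big)+\partial R(x^\star)$. Distributed PDDY Algorithm: given positive stepsizes $(\gamma_k)_{k\in\mathbb{N}}$, $\eta>0$, $x_R^0\in\mathcal{X}$, $u_m^0\in\mathcal{U}_m$, set $p_m^0=K_m^*u_m^0$,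 $m=1,\ldots,M$. For $k=0,1,\ldots$ iterate: for $m=1,\ldots,M$, $$u_m^{k+1}=\mathrm{prox}_{M\omega_mH_m^*/(\gamma_k\eta)}\Big(u_m^k+\tfrac{M\omega_m}{\gamma_k\eta}K_mx_R^k\Big),\quad p_m^{k+1}=K_m^*u_m^{k+1},$$ $$x_m^{k+1}=x_R^k-\tfrac{\gamma_k}{M\omega_m}(p_m^{k+1}-p_m^k),\quad a_m^k=M\omega_mx_m^{k+1}-\gamma_{k+1}\nabla F_m(x_m^{k+1})-\gamma_{k+1}p_m^{k+1},$$ and then $x_R^{k+1}=\mathrm{prox}_{\gamma_{k+1}R}\big(\frac1M\sum_{m=1}^Ma_m^k\big)$. *)

(* Defs.v *)
From HB Require Import structures.
From mathcomp Require Import all_boot all_order all_algebra.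
From mathcomp Require Import all_classical all_reals all_analysis.

Set Implicit Arguments.
Unset Strict Implicit.
Unset Printing Implicit Defensive.

Import Order.TTheory GRing.Theory Num.Theory.
Import numFieldNormedType.Exports.

Local Open Scope classical_set_scope.
Local Open Scope ring_scope.

(* A finite-dimensional real Hilbert space is a normed module that is also a
   [vectType] and whose norm comes from a symmetric bilinear form.  Positive
   definiteness follows from [norm_inner], completeness from finiteness of the
   dimension. *)
HB.mixin Record isEuclidean (R : realType) V
    of NormedModule R V & Vector R V := {
  inner : V -> V -> R ;
  innerC : forall x y, inner x y = inner y x ;
  inner_linearl : forall (c : R) x y z,
    inner (c *: x + y) z = c * inner x z + inner y z ;
  norm_inner : forall x, `|x| ^+ 2 = inner x x
}.

#[short(type="euclideanType")]
HB.structure Definition Euclidean (R : realType) :=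
  {V of NormedModule R V & Vector R V & isEuclidean R V}.

Section ConvexAnalysis.
Context {R : realType}.
Local Open Scope ereal_scope.

Definition is_argmin (T : Type) (f : T -> \bar R) (x : T) : Prop :=
  forall y, f x <= f y.

Definition proper (T : Type) (G : T -> \bar R) : Prop :=
  (forall x, G x != -oo) /\ (exists x, G x != +oo).

(* [convex_function] of the library only covers real-valued functions.  The
   product 0 * +oo is 0, so t = 0 and t = 1 impose nothing. *)
Definition econvex (V : lmodType R) (G : V -> \bar R) : Prop :=
  forall (x y : V) (t : R), (0 <= t <= 1)%R ->
    G (t *: x + (1 - t) *: y)%R <= t%:E * G x + (1 - t)%:E * G y.

Definition proper_closed_convex (V : euclideanType R) (G : V -> \bar R) : Prop :=
  [/\ proper G, lower_semicontinuous G & econvex G].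

Definition subdiff (V : euclideanType R) (G : V -> \bar R) (x : V) : set V :=
  [set s | forall y, G x + (inner s (y - x)%R)%:E <= G y].

Definition conjugate (V : euclideanType R) (G : V -> \bar R) (s : V) : \bar R :=
  ereal_sup [set (inner s x)%:E - G x | x in [set: V]].

(* [is_prox G z p] says p = prox_G(z); the proximity operator is handled through
   its graph. *)
Definition is_prox (V : euclideanType R) (G : V -> \bar R) (z p : V) : Prop :=
  is_argmin (fun z' => G z' + (2^-1 * `|z - z'| ^+ 2)%:E) p.

End ConvexAnalysis.

Section Constants.
Context {R : realType}.

Definition opnorm (V W : normedModType R) (f : V -> W) : R :=
  sup [set `|f x| | x in [set x : V | `|x| <= 1]].

(* Extrema over a nonempty index set; the default value of the iterated operator
   is one of the terms. *)
Definition max_ord (M : nat) (M_gt0 : (0 < M)%N) (f : 'I_M -> R) : R :=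
  \big[Num.max/f (Ordinal M_gt0)]_(m < M) f m.

Definition min_ord (M : nat) (M_gt0 : (0 < M)%N) (f : 'I_M -> R) : R :=
  \big[Num.min/f (Ordinal M_gt0)]_(m < M) f m.

End Constants.

Section DistributedProblem.
Context {R : realType} {X : euclideanType R} {M : nat}.
Context {U : 'I_M -> euclideanType R}.

Definition objective (F : 'I_M -> X -> R) (H : forall m, U m -> \bar R)
    (K : forall m, X -> U m) (Rg : X -> \bar R) (x : X) : \bar R :=
  ((M%:R^-1)%:E * (\sum_(m < M) ((F m x)%:E + H m (K m x))) + Rg x)%E.

(* 0 \in 1/M \sum_m (gF m x + K_m^* \partial H_m (K_m x)) + \partial Rg x *)
Definition zero_inclusion (gF : 'I_M -> X -> X) (H : forall m, U m -> \bar R)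
    (K : forall m, X -> U m) (Kadj : forall m, U m -> X) (Rg : X -> \bar R)
    (x : X) : Prop :=
  exists (v : forall m, U m) (r : X),
    [/\ forall m, subdiff (H m) (K m x) (v m),
        subdiff Rg x r &
        M%:R^-1 *: (\sum_(m < M) (gF m x + Kadj m (v m))) + r = 0].

(* [x m 0] is not part of the algorithm and is left unconstrained. *)
Record is_distributed_PDDY (gF : 'I_M -> X -> X) (H : forall m, U m -> \bar R)
    (K : forall m, X -> U m) (Kadj : forall m, U m -> X) (Rg : X -> \bar R)
    (omega : 'I_M -> R) (gamma : nat -> R) (eta : R)
    (xR : nat -> X) (u : forall m, nat -> U m) (p : 'I_M -> nat -> X)
    (x : 'I_M -> nat -> X) (a : 'I_M -> nat -> X) : Prop := {
  PDDY_p : forall m k, p m k = Kadj m (u m k) ;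
  PDDY_u : forall m k,
    let c := M%:R * omega m / (gamma k * eta) in
    is_prox (fun v => c%:E * conjugate (H m) v)%E
            (u m k + c *: K m (xR k)) (u m k.+1) ;
  PDDY_x : forall m k,
    x m k.+1 = xR k - (gamma k / (M%:R * omega m)) *: (p m k.+1 - p m k) ;
  PDDY_a : forall m k,
    a m k = (M%:R * omega m) *: x m k.+1
            - gamma k.+1 *: gF m (x m k.+1) - gamma k.+1 *: p m k.+1 ;
  PDDY_xR : forall k,
    is_prox (fun z => (gamma k.+1)%:E * Rg z)%E
            (M%:R^-1 *: \sum_(m < M) a m k) (xR k.+1)
}.

End DistributedProblem.

(* Main.v *)
Require Import Defs.
From HB Require Import structures.
From mathcomp Require Import all_boot all_order all_algebra.
From mathcomp Require Import all_classical all_reals all_analysis.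
From mathcomp Require Import ring lra.

(** The iteration is a forward-backward scheme in the product space of copies of
    the primal variable, weighted by omega, and the theorem follows from one
    Lyapunov inequality.  Let xs be the primal solution, v m a dual solution,
    w m = M * omega m, and fix a worker m.  Monotonicity of the subdifferentials
    of H_m^* and R along the two proximal steps, together with the expansion of
    |x m k.+2 - xs|^2, leaves a square that can be dropped and the terms
      - 2 tau <x - xs, dg> + tau^2 |dg|^2,   tau = gamma k.+1 / w m,
    where dg is the difference of the gradients at x m k.+1 and at xs
    ([worker_step]).  The gradient is cocoercive (Baillon-Haddad,
    [cocoercive]) and strongly monotone, so a share kappa of the inner product
    is left and these terms are at most
    - 2 kappa muhat gamma |x - xs|^2 ([smooth_strongly_monotone_step]).
    The R-terms of the workers have a sign only after summation, because the
    workers share the server variable ([primal_monotone]).  The result is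
    [lyapunov_decrease]:
      S' + gamma^2 D' <= (1 - 2 kappa muhat gamma) S + gamma^2 D,
    S and D being the weighted squared distances of the primal and dual
    iterates to their limits.

    The recursion of the stepsizes is exactly
      (1 - 2 kappa muhat gamma_{k+1}) / gamma_{k+1}^2 = 1 / gamma_k^2
    ([step_recurrence]), so S_{k+1} / gamma_k^2 + D_{k+1} does not increase
    ([potential_decr]).  It also makes 1 / gamma_k grow by at least
    kappa muhat at each step, which is the rate gamma_k = O(1/k) ([step_rate]),
    while gamma_k / gamma_{k+1} stays bounded ([step_ratio]).  The latter is how
    the bound S_{k+1} <= C gamma_k^2 becomes a bound by gamma_{k+1}^2.

    For the server variable, x m k.+1 and xR k differ by gamma_k / w m times
    the adjoint of K m applied to a difference of two dual iterates, and the
    dual iterates are bounded by the potential ([server_rate]).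

    In the case where all F_m vanish, muhat > 0 forces the primal space to be
    trivial, so that the operator bound |K_m^* w|^2 <= eta |w|^2, which makes
    the dual terms controllable, holds in both cases. *)

Set Implicit Arguments.
Unset Strict Implicit.
Unset Printing Implicit Defensive.

Import Order.TTheory GRing.Theory Num.Theory.
Import numFieldNormedType.Exports.

Local Open Scope classical_set_scope.
Local Open Scope ring_scope.

(** * Inner products and bounded operators *)

Section InnerProduct.
Context {R : realType} {V : euclideanType R}.
Implicit Types (x y z : V) (c : R).

Lemma inner0l x : inner (0 : V) x = 0.
Proof.
by have := inner_linearl 1 (0 : V) 0 x; rewrite scaler0 addr0 mul1r; lra.
Qed.

Lemma innerDl x y z : inner (x + y) z = inner x z + inner y z.
Proof. by rewrite -[x in LHS]scale1r inner_linearl mul1r. Qed.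

Lemma innerZl c x z : inner (c *: x) z = c * inner x z.
Proof. by rewrite -[c *: x]addr0 inner_linearl inner0l addr0. Qed.

Lemma innerNl x z : inner (- x) z = - inner x z.
Proof. by rewrite -scaleN1r innerZl mulN1r. Qed.

Lemma innerBl x y z : inner (x - y) z = inner x z - inner y z.
Proof. by rewrite innerDl innerNl. Qed.

Lemma inner0r x : inner x (0 : V) = 0.
Proof. by rewrite innerC inner0l. Qed.

Lemma innerDr x y z : inner z (x + y) = inner z x + inner z y.
Proof. by rewrite innerC innerDl !(innerC z). Qed.

Lemma innerZr c x z : inner z (c *: x) = c * inner z x.
Proof. by rewrite innerC innerZl (innerC z). Qed.

Lemma innerNr x z : inner z (- x) = - inner z x.
Proof. by rewrite innerC innerNl (innerC z). Qed.

Lemma innerBr x y z : inner z (x - y) = inner z x - inner z y.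
Proof. by rewrite innerDr innerNr. Qed.

Definition innerE :=
  (@norm_inner R V, innerDl, innerBl, innerNl, innerZl, inner0l,
   innerDr, innerBr, innerNr, innerZr, inner0r).

Lemma inner_sumr (I : finType) (f : I -> V) z :
  inner z (\sum_i f i) = \sum_i inner z (f i).
Proof.
by apply: (big_morph (inner z)) => [x y|]; rewrite ?innerDr ?inner0r.
Qed.

Lemma inner_ge0 x : 0 <= inner x x.
Proof. by rewrite -norm_inner exprn_ge0. Qed.

Lemma inner_eq0 x : inner x x = 0 -> x = 0.
Proof. by rewrite -norm_inner => /eqP; rewrite sqrf_eq0 normr_eq0 => /eqP. Qed.

(** Reduces identities between linear combinations of vectors to identities
    between scalars, which the field tactic decides. *)
Lemma inner_inj x y : (forall z, inner x z = inner y z) -> x = y.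
Proof.
move=> xy; apply/eqP; rewrite -subr_eq0; apply/eqP/inner_eq0.
by rewrite innerBl xy subrr.
Qed.

Lemma norm_subZ x y (t : R) :
  `|x - t *: y| ^+ 2 = `|x| ^+ 2 - 2 * t * inner x y + t ^+ 2 * `|y| ^+ 2.
Proof. by rewrite !innerE (innerC y x); ring. Qed.

Lemma cauchy_schwarz x y : inner x y <= `|x| * `|y|.
Proof.
have [->|y0] := eqVneq y 0; first by rewrite inner0r normr0 mulr0.
have ny : 0 < `|y| by rewrite normr_gt0.
have [->|x0] := eqVneq x 0; first by rewrite inner0l normr0 mul0r.
have nx : 0 < `|x| by rewrite normr_gt0.
have := inner_ge0 (`|y| *: x - `|x| *: y).
have -> : inner (`|y| *: x - `|x| *: y) (`|y| *: x - `|x| *: y) =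
    2 * (`|x| * `|y|) * (`|x| * `|y| - inner x y).
  by rewrite !innerE -!norm_inner (innerC y x); ring.
by rewrite pmulr_rge0 ?subr_ge0// !mulr_gt0.
Qed.

Lemma sqr_norm_subD x y : `|x - y| ^+ 2 <= 2 * (`|x| ^+ 2 + `|y| ^+ 2).
Proof.
have := inner_ge0 (x + y).
by rewrite !innerE (innerC y x); lra.
Qed.

End InnerProduct.

Section BoundedOperators.
Context {R : realType}.

Definition gram (V : euclideanType R) (v : V) : 'rV[R]_(\dim {:V}) :=
  \row_i inner v (vbasis {:V})`_i.

Lemma gram_linear (V : euclideanType R) : linear (@gram V).
Proof.
by move=> c x y; apply/rowP => i; rewrite !mxE inner_linearl.
Qed.

HB.instance Definition _ (V : euclideanType R) :=
  GRing.isLinear.Build R V 'rV[R]_(\dim {:V}) *:%R (@gram V) (@gram_linear V).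

Lemma gram_ker (V : euclideanType R) : lker (linfun (@gram V)) == 0%VS.
Proof.
apply/lker0P => x y; rewrite !lfunE /= => xy.
apply/eqP; rewrite -subr_eq0; apply/eqP/inner_eq0.
rewrite {2}(coord_vbasis (memvf (x - y))) inner_sumr big1// => i _.
have /rowP/(_ i) : gram (x - y) = 0 by rewrite linearB /= xy subrr.
by rewrite !mxE innerZr => ->; rewrite mulr0.
Qed.

(** The map [gram] is injective, so every vector is a combination of fixed
    vectors whose coefficients are its inner products with a basis.  For A v
    these coefficients are inner products of v with fixed vectors, by the
    adjoint, hence bounded by a multiple of the norm of v.  Without this bound
    the supremum [opnorm] of an unbounded set would carry no information. *)
Lemma adjoint_bounded (V W : euclideanType R) (A : V -> W) (B : W -> V) :
  (forall v w, inner (A v) w = inner v (B w)) ->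
  exists C, forall v, `|A v| <= C * `|v|.
Proof.
move=> AB.
pose e := vbasis {:W}.
pose G := linfun (@gram W).
exists (\sum_(i < \dim {:W}) `|B e`_i| * `|(G^-1)%VF (delta_mx 0 i)|) => v.
have -> : A v = \sum_(i < \dim {:W}) inner v (B e`_i) *: (G^-1)%VF (delta_mx 0 i).
  have -> : A v = (G^-1)%VF (gram (A v)).
    by rewrite -[gram _]lfunE -comp_lfunE lker0_compVf ?gram_ker// id_lfunE.
  rewrite {1}(row_sum_delta (gram (A v))) linear_sum.
  by apply: eq_bigr => i _; rewrite linearZ /= mxE AB.
apply: (le_trans (ler_norm_sum _ _ _)).
rewrite mulr_suml; apply: ler_sum => i _.
rewrite normrZ mulrAC ler_wpM2r//.
rewrite ler_norml mulrC cauchy_schwarz andbT lerNl -innerNr.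
by rewrite (le_trans (cauchy_schwarz _ _))// normrN.
Qed.

Lemma le_opnorm (V W : euclideanType R) (A : {linear V -> W}) (B : W -> V) :
  (forall v w, inner (A v) w = inner v (B w)) ->
  forall v, `|A v| <= opnorm A * `|v|.
Proof.
move=> AB v; have [C AC] := adjoint_bounded AB.
have [->|v0] := eqVneq v 0; first by rewrite linear0 !normr0 mulr0.
have nv : 0 < `|v| by rewrite normr_gt0.
rewrite -ler_pdivrMr//.
have -> : `|A v| / `|v| = `|A (`|v|^-1 *: v)|.
  by rewrite linearZ normrZ mulrC ger0_norm// invr_ge0.
apply: ub_le_sup.
  exists `|C| => _ [x /= x1 <-].
  apply: (le_trans (AC x)).
  apply: (le_trans (ler_wpM2r (normr_ge0 x) (ler_norm C))).
  by rewrite ler_piMr.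
by exists (`|v|^-1 *: v) => //=; rewrite normrZ ger0_norm ?invr_ge0// mulVf ?gt_eqF.
Qed.

(** An operator and its adjoint have the same norm:
    |B w|^2 = <A (B w), w> <= opnorm A * |B w| * |w|. *)
Lemma le_opnorm_adjoint (V W : euclideanType R) (A : {linear V -> W})
    (B : W -> V) :
  (forall v w, inner (A v) w = inner v (B w)) ->
  forall w, `|B w| ^+ 2 <= opnorm A ^+ 2 * `|w| ^+ 2.
Proof.
move=> AB w; have [->|Bw0] := eqVneq (B w) 0.
  by rewrite normr0 expr0n -exprMn sqr_ge0.
have nB : 0 < `|B w| by rewrite normr_gt0.
have opA_ge0 : 0 <= opnorm A.
  rewrite -(pmulr_lge0 _ nB).
  exact: (le_trans (normr_ge0 (A (B w))) (le_opnorm AB _)).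
rewrite -exprMn ler_sqr ?nnegrE ?mulr_ge0//.
rewrite -(ler_pM2r nB) -expr2 norm_inner -AB.
apply: (le_trans (cauchy_schwarz _ _)); rewrite mulrAC ler_wpM2r//.
exact: le_opnorm.
Qed.

End BoundedOperators.

(** * Smooth and strongly convex functions *)

Lemma ler_vanishing (R : realType) (a b c : R) :
  (forall t, 0 < t -> t <= 1 -> a <= b + t * c) -> a <= b.
Proof.
move=> abc; apply/ler_addgt0Pr => e e0.
have [c0|c0] := leP c 0; first by have := abc 1; rewrite !ltr01 mul1r; lra.
pose t := Num.min 1 (e / c).
have t0 : 0 < t by rewrite lt_min ltr01 divr_gt0.
have := abc t t0; rewrite ge_min lexx => /(_ isT) /le_trans; apply.
by rewrite lerD2l -ler_pdivlMr// ge_min lexx orbT.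
Qed.

Section SmoothStronglyConvex.
Context {R : realType} {X : euclideanType R}.
Implicit Types (f : X -> R) (g : X -> X).

Lemma directional_derivative_le f (x s d : X) (b c : R) :
  is_diff x f (inner s) ->
  (forall t, 0 < t -> t <= 1 -> f (x + t *: d) <= f x + t * (b + t * c)) ->
  inner s d <= b.
Proof.
move=> [dif difE] fle.
have Dd : 'D_d f x = inner s d by rewrite deriveE// difE.
have cv : h^-1 *: (f (h *: d + x) - f x) @[h --> (0 : R)^'+] --> inner s d.
  by apply: cvg_dnbhs_at_right; rewrite -Dd; exact: diff_derivable.
have cv' : b + h * c @[h --> (0 : R)^'+] --> b.
  apply: cvg_at_right_filter.
  have : b + h * c @[h --> (0 : R)] --> b + 0 * c.
    by apply: cvgD; [exact: cvg_cst|apply: cvgM; [exact: cvg_id|exact: cvg_cst]].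
  by rewrite mul0r addr0.
apply: (ler_cvg_to cv cv'); near=> h.
have h0 : 0 < h by near: h; exact: nbhs_right_gt.
have h1 : h <= 1 by near: h; exact: nbhs_right_le.
rewrite -[_ *: _]/(_ * _) mulrC ler_pdivrMr// lerBlDl addrC [X in f X]addrC.
by rewrite (mulrC _ h) addrC fle.
Unshelve. all: by end_near. Qed.

(** Along the segment from x to y, strong convexity bounds the difference
    quotient of f by f y - f x - mu/2 |y - x|^2 up to a term that vanishes with
    the step. *)
Lemma strongly_convex_gradient f (mu : R) (x s y : X) :
  is_diff x f (inner s) ->
  convex_function [set: X] (fun x : X => f x - mu / 2 * `|x| ^+ 2) ->
  f x + inner s (y - x) + mu / 2 * `|y - x| ^+ 2 <= f y.
Proof.
move=> fx cf; rewrite addrAC -lerBrDl.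
apply: (directional_derivative_le (c := mu / 2 * `|y - x| ^+ 2) fx) => t t0 t1.
have t01 : 0 <= t <= 1 by rewrite ltW.
have := cf (Itv01 (ltW t0) t1) y x; rewrite !in_setT => /(_ isT isT).
rewrite convRE /conv /= /unstable.onem.
have -> : (t *: y + (1 - t) *: x : X) = x + t *: (y - x).
  by rewrite scalerBl scale1r scalerBr addrCA.
by rewrite !innerE !(innerC y x); lra.
Qed.

Section BaillonHaddad.
Variables (f : X -> R) (g : X -> X) (L : R).
Hypothesis L0 : 0 < L.
Hypothesis f_ge_tangent : forall x y, f x + inner (g x) (y - x) <= f y.
Hypothesis g_lip : forall x y, `|g x - g y| <= L * `|x - y|.

(** Convexity and the Lipschitz bound give the descent inequality with the
    constant L instead of L / 2.  If it holds with a constant C, then applying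
    it to the two halves of a segment gives C / 2 + L / 4, a map that halves the
    distance to its fixed point L / 2. *)
Let descent_step n x y :
  f y <= f x + inner (g x) (y - x) + (L / 2 + L / 2 / 2 ^+ n) * `|y - x| ^+ 2.
Proof.
have gL a b : inner (g a - g b) (a - b) <= L * `|a - b| ^+ 2.
  apply: (le_trans (cauchy_schwarz _ _)).
  by rewrite expr2 mulrA ler_wpM2r.
elim: n x y => [|n IH] x y.
  have := f_ge_tangent y x; have := gL y x.
  rewrite -(opprB y x) innerNr innerBl expr0; lra.
pose z := x + 2^-1 *: (y - x).
have yz : y - z = 2^-1 *: (y - x).
  rewrite /z opprD addrA -[X in X - _]scale1r -scalerBl.
  by congr (_ *: _); lra.
have zx : z - x = 2^-1 *: (y - x) by rewrite /z addrC addKr.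
have := IH z y; have := IH x z; have := gL z x.
rewrite yz zx !normrZ !innerZr innerBl (@ger0_norm _ 2^-1)// !exprMn (exprS _ n).
have : 0 < 2 ^+ n :> R by rewrite exprn_gt0.
set q := `|y - x| ^+ 2; set w := 2 ^+ n => w0.
rewrite invfM; move: (w^-1) => v; lra.
Qed.

Lemma descent x y : f y <= f x + inner (g x) (y - x) + L / 2 * `|y - x| ^+ 2.
Proof.
apply/ler_addgt0Pr => e e0.
pose c := L / 2 * `|y - x| ^+ 2.
have c0 : 0 <= c by rewrite mulr_ge0 ?sqr_ge0// divr_ge0// ltW.
have e'0 : 0 < e / (c + 1) by rewrite divr_gt0// ltr_wpDl.
have [n _ /(_ n (leqnn n))] := near_infty_natSinv_expn_lt (PosNum e'0).
rewrite /= ltr_pdivlMr ?ltr_wpDl// => ne.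
have := descent_step n x y.
have : 0 < 1 / 2 ^+ n :> R by rewrite divr_gt0// exprn_gt0.
move: ne; rewrite /c !div1r; move: ((2 ^+ n)^-1) (`|y - x| ^+ 2) => v q.
move=> h1 h2 /le_trans; apply; lra.
Qed.

(** The function f - <g a, .> is minimal at a; comparing its value at a with its
    value after a gradient step of length 1 / L from b gives [half].  The two
    inequalities obtained by exchanging a and b add up to the claim. *)
Lemma cocoercive x y : `|g x - g y| ^+ 2 <= L * inner (g x - g y) (x - y).
Proof.
suff half a b : f a + inner (g a) (b - a) + `|g b - g a| ^+ 2 / L / 2 <= f b.
  have := half x y; have := half y x.
  rewrite (distrC (g y)) -(opprB x y) innerNr => h1 h2.
  rewrite mulrC -ler_pdivrMr// innerBl; lra.
pose z := b - L^-1 *: (g b - g a).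
have := le_trans (f_ge_tangent a z) (descent b z).
have -> : z - a = (b - a) - L^-1 *: (g b - g a) by rewrite /z addrAC.
have -> : z - b = - (L^-1 *: (g b - g a)) by rewrite /z addrC addKr.
rewrite normrN normrZ exprMn ger0_norm ?invr_ge0 ?(ltW L0)//.
rewrite (innerBr (b - a)) innerNr !innerZr.
have -> : L / 2 * (L^-1 ^+ 2 * `|g b - g a| ^+ 2) =
   `|g b - g a| ^+ 2 / L / 2 by field; rewrite gt_eqF.
have : L^-1 * `|g b - g a| ^+ 2 =
    L^-1 * (inner (g b) (g b - g a) - inner (g a) (g b - g a)).
  by rewrite norm_inner [in LHS]innerBl.
lra.
Qed.

End BaillonHaddad.
End SmoothStronglyConvex.

(** * Proximity operators and conjugates *)

Section Proximity.
Context {R : realType} {V : euclideanType R}.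
Implicit Types (G : V -> \bar R) (x y z p s : V).

Lemma subdiff_fin_num G x s : Defs.proper G -> subdiff G x s -> G x \is a fin_num.
Proof.
move=> [Gny [y Gy]] /(_ y); have := Gny x; rewrite fin_numE => -> /=.
by apply: contraTneq => ->; rewrite addye// leye_eq.
Qed.

(** The vector (z - p) / c is a subgradient of G at p, and s is one at y: this
    is monotonicity of the subdifferential.  The optimality of p is tested at
    points of the segment from p to y. *)
Lemma is_prox_monotone G (c : R) z p s y :
  0 < c -> (forall x, G x != -oo%E) -> econvex G ->
  is_prox (fun v => c%:E * G v)%E z p ->
  subdiff G y s -> G y \is a fin_num ->
  0 <= inner (z - p - c *: s) (p - y).
Proof.
move=> c0 Gny cG pG sG Gy.
have Gp : G p \is a fin_num.
  rewrite fin_numE Gny /=; have := pG y; apply: contraTneq => ->.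
  rewrite mulry gtr0_sg// mul1e addye// leye_eq.
  by rewrite -(fineK Gy) -EFinM -EFinD.
move: (fineK Gy) (fineK Gp); move: (fine _) (fine _) => b a /esym Ea /esym Eb.
have key : inner (z - p) (y - p) <= c * (a - b).
  apply: (@ler_vanishing _ _ _ (2^-1 * `|y - p| ^+ 2)) => t t0 t1.
  have := pG (t *: y + (1 - t) *: p).
  have t01 : 0 <= t <= 1 by rewrite ltW.
  have /(lee_wpmul2l (ltW c0 : (0 <= c%:E)%E)) := cG y p t t01.
  rewrite Eb Ea -!EFinM -!EFinD => le1 le2.
  have := le_trans le2 (leeD2r _ le1).
  rewrite -!EFinD lee_fin.
  have -> : z - (t *: y + (1 - t) *: p) = (z - p) - t *: (y - p).
    by rewrite scalerBl scale1r scalerBr addrCA opprD addrA.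
  rewrite norm_subZ => le3.
  rewrite -(ler_pM2l t0); lra.
have := sG p; rewrite Eb Ea -EFinD lee_fin.
rewrite -(ler_pM2l c0) => le4.
move: le4; rewrite innerBl innerZl -(opprB y p) !innerNr; lra.
Qed.

End Proximity.

Section Conjugate.
Context {R : realType} {V : euclideanType R}.
Variable H : V -> \bar R.
Hypothesis H_proper : Defs.proper H.
Local Open Scope ereal_scope.

Lemma conjugate_ge v w : (inner v w)%:E - H w <= conjugate H v.
Proof. by apply: ereal_sup_ubound; exists w. Qed.

Lemma conjugate_neq_ninfty v : conjugate H v != -oo.
Proof.
have [Hny [w Hw]] := H_proper.
have Hwf : H w \is a fin_num by rewrite fin_numE Hny.
rewrite gt_eqF//; apply: lt_le_trans (conjugate_ge v w).
by rewrite -(fineK Hwf) -EFinB ltNyr.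
Qed.

Lemma conjugate_convex : econvex (conjugate H).
Proof.
move=> x y t /andP[t0 t1]; apply: ge_ereal_sup => _ [w _ <-].
have [Hny _] := H_proper.
have [->|Hw] := eqVneq (H w) +oo; first by rewrite addeNy leNye.
have Hwf : H w \is a fin_num by rewrite fin_numE Hny.
have -> : (inner (t *: x + (1 - t) *: y)%R w)%:E - H w =
   t%:E * ((inner x w)%:E - H w) + (1 - t)%:E * ((inner y w)%:E - H w).
  rewrite -(fineK Hwf) -!EFinB -!EFinM -EFinD innerDl !innerZl.
  by congr EFin; ring.
by apply: leeD; apply: lee_wpmul2l; rewrite ?lee_fin ?subr_ge0//;
  exact: conjugate_ge.
Qed.

Lemma conjugate_subgradient x v : subdiff H x v ->
  conjugate H v = (inner v x)%:E - H x.
Proof.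
move=> xv; apply/eqP; rewrite eq_le conjugate_ge andbT.
have Hx := subdiff_fin_num H_proper xv.
apply: ge_ereal_sup => _ [w _ <-].
have := xv w; rewrite -(fineK Hx) -EFinD -EFinB.
have [Hny _] := H_proper.
have [->|Hw] := eqVneq (H w) +oo; first by rewrite addeNy leNye.
have Hwf : H w \is a fin_num by rewrite fin_numE Hny.
by rewrite -(fineK Hwf) -EFinB !lee_fin innerBr; lra.
Qed.

(** Dual solutions are given as subgradients of H, whereas the dual step of the
    algorithm is a proximal step on the conjugate. *)
Lemma conjugate_subdiff x v : subdiff H x v -> subdiff (conjugate H) v x.
Proof.
move=> xv w; have Hx := subdiff_fin_num H_proper xv.
apply: le_trans (conjugate_ge w x).
rewrite (conjugate_subgradient xv) -(fineK Hx) -!EFinB -EFinD lee_fin.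
by rewrite innerBr !(innerC x); lra.
Qed.

Lemma conjugate_fin_num x v :
  subdiff H x v -> conjugate H v \is a fin_num.
Proof.
move=> xv; have Hx := subdiff_fin_num H_proper xv.
by rewrite (conjugate_subgradient xv) -(fineK Hx) -EFinB.
Qed.

End Conjugate.

(** * One iteration of one worker *)

Section WorkerStep.
Context {R : realType} {X W : euclideanType R}.

(** Here dx, dxr, du, dup are the differences from the solution of the
    current primal point, the server point, the current and the next dual
    point; dg is the gradient difference and B the adjoint of the operator of
    the worker.  Thus dxr - tau *: B (dup - du) is the next primal error.  The
    vector e / tau is the share of this worker in the subgradient of R, relative
    to the solution.  The third hypothesis is the monotonicity of the dual step.
    The difference of the two sides is the sum of tau^2 times the nonnegative
    quantity eta |dup - du|^2 - |B (dup - du)|^2, of 2 tau times the inner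
    products of the third hypothesis, and of the square |e + tau B du|^2. *)
Lemma worker_step (B : {linear W -> X}) (eta tau : R) (dx dxr dg e : X)
    (du dup : W) :
  0 <= tau ->
  (forall w, `|B w| ^+ 2 <= eta * `|w| ^+ 2) ->
  0 <= inner (tau * eta *: (du - dup)) dup + inner dxr (B dup) ->
  dx = dxr + tau *: (dg + B du) + e ->
  `|dxr - tau *: B (dup - du)| ^+ 2 + tau ^+ 2 * eta * `|dup| ^+ 2 <=
  `|dx| ^+ 2 + tau ^+ 2 * eta * `|du| ^+ 2
  - (2 * tau * inner dg dx - tau ^+ 2 * `|dg| ^+ 2) - 2 * inner dxr e.
Proof.
move=> tau0 Beta dual ->.
have := mulr_ge0 tau0 dual.
have := ler_wpM2l (sqr_ge0 tau) (Beta (dup - du)).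
have := sqr_ge0 `|e + tau *: B du|.
move: e => f {dual}.
rewrite linearB; move: (B du) (B dup) => p q.
rewrite !innerE (innerC f dxr) (innerC dg dxr) (innerC p dxr) (innerC q dxr).
rewrite (innerC dg f) (innerC p f) (innerC p dg).
rewrite (innerC q p) (innerC dup du).
lra.
Qed.

(** Since tau L <= 2 (1 - kappa), cocoercivity absorbs tau^2 |dg|^2 into the
    part 2 (1 - kappa) tau <dg, dx>; strong monotonicity is applied to the part
    2 kappa tau <dg, dx> that is left. *)
Lemma smooth_strongly_monotone_step (tau L mu kappa : R) (dx dg : X) :
  0 <= tau -> tau * L <= 2 * (1 - kappa) -> 0 <= kappa -> 0 <= mu ->
  `|dg| ^+ 2 <= L * inner dg dx ->
  mu * `|dx| ^+ 2 <= inner dg dx ->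
  2 * kappa * (tau * mu) * `|dx| ^+ 2 <=
  2 * tau * inner dg dx - tau ^+ 2 * `|dg| ^+ 2.
Proof.
move=> tau0 tauL kappa0 mu0 coc mon.
have i0 : 0 <= inner dg dx by apply: le_trans mon; rewrite mulr_ge0 ?sqr_ge0.
have := ler_wpM2l (sqr_ge0 tau) coc.
have := ler_wpM2l (mulr_ge0 tau0 i0) tauL.
have := ler_wpM2l (mulr_ge0 kappa0 tau0) mon.
lra.
Qed.

End WorkerStep.

(** * The stepsizes *)

Section StepSizes.
Context {R : realType}.
Variables (gamma : nat -> R) (c : R).
Hypothesis c_gt0 : 0 < c.
Hypothesis gamma1_gt0 : 0 < gamma 1.
Hypothesis gammaS : forall k, (1 <= k)%N ->
  gamma k.+1 = - gamma k ^+ 2 * c + gamma k * Num.sqrt ((gamma k * c) ^+ 2 + 1).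

Lemma step_gt0 k : (1 <= k)%N -> 0 < gamma k.
Proof.
elim: k => // -[|k] IH _ //; have g0 := IH isT.
rewrite gammaS// mulNr addrC subr_gt0 expr2 -mulrA ltr_pM2l//.
have gc0 : 0 <= gamma k.+1 * c by rewrite mulr_ge0 ?ltW.
rewrite -(ltr_pXn2r (n := 2)) ?nnegrE ?sqrtr_ge0// sqr_sqrtr.
  by rewrite ltrDl.
by rewrite addr_ge0 ?sqr_ge0.
Qed.

(** The stepsize gamma_{k+1} is the positive root of
    g^2 + 2 c gamma_k^2 g = gamma_k^2. *)
Lemma step_recurrence k : (1 <= k)%N ->
  gamma k.+1 ^+ 2 = gamma k ^+ 2 * (1 - 2 * c * gamma k.+1).
Proof.
move=> k1.
have : Num.sqrt ((gamma k * c) ^+ 2 + 1) ^+ 2 = (gamma k * c) ^+ 2 + 1.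
  by rewrite sqr_sqrtr// addr_ge0 ?sqr_ge0.
rewrite gammaS//; move: (Num.sqrt _) => s; move: (gamma k) => g sE.
have -> : (- g ^+ 2 * c + g * s) ^+ 2 =
  g ^+ 4 * c ^+ 2 - 2 * g ^+ 3 * c * s + g ^+ 2 * s ^+ 2 by ring.
by rewrite sE; ring.
Qed.

Lemma step_lt_half k : (2 <= k)%N -> 2 * c * gamma k < 1.
Proof.
case: k => // -[|k]// _; have g0 := step_gt0 (ltn0Sn k).
have := exprn_gt0 2 (step_gt0 (ltn0Sn k.+1)).
by rewrite step_recurrence// pmulr_rgt0 ?exprn_gt0// subr_gt0.
Qed.

Lemma step_decr k : (1 <= k)%N -> gamma k.+1 <= gamma k.
Proof.
move=> k1; have g0 := step_gt0 k1; have g1 := step_gt0 (leqW k1).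
rewrite -(ler_pXn2r (n := 2)) ?nnegrE ?(ltW g0) ?(ltW g1)// step_recurrence//.
by rewrite ler_piMr ?sqr_ge0// lerBlDr lerDl !mulr_ge0 ?ltW.
Qed.

Lemma step_le1 k : (1 <= k)%N -> gamma k <= gamma 1.
Proof.
elim: k => // -[|k] IH _ //.
exact: le_trans (step_decr (ltn0Sn k)) (IH isT).
Qed.

(** From gamma_{k+1} (gamma_{k+1} + 2 c gamma_k^2) = gamma_k^2 and
    gamma_{k+1} <= gamma_k <= gamma_1. *)
Lemma step_ratio k : (1 <= k)%N ->
  gamma k <= (1 + 2 * c * gamma 1) * gamma k.+1.
Proof.
move=> k1; have g0 := step_gt0 k1; have g1 := step_gt0 (leqW k1).
have c1 : 2 * c * gamma k <= 2 * c * gamma 1.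
  by rewrite ler_pM2l ?mulr_gt0// step_le1.
suff le : gamma k <= (1 + 2 * c * gamma k) * gamma k.+1.
  by apply: (le_trans le); rewrite ler_pM2r// lerD2l.
rewrite -(ler_pM2l g0).
have := step_recurrence k1.
have := ler_wpM2r (ltW g1) (step_decr k1).
lra.
Qed.

(** The difference gamma_k^2 - gamma_{k+1}^2 = 2 c gamma_{k+1} gamma_k^2 is at
    most 2 gamma_k (gamma_k - gamma_{k+1}). *)
Lemma step_inv_incr k : (1 <= k)%N -> (gamma k)^-1 + c <= (gamma k.+1)^-1.
Proof.
move=> k1; have g0 := step_gt0 k1; have g1 := step_gt0 (leqW k1).
have := step_decr k1; have := step_recurrence k1.
move: (gamma k) (gamma k.+1) g0 g1 => g h g0 h0 rec hg.
rewrite -(ler_pM2l (mulr_gt0 g0 h0)).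
have -> : g * h * (g^-1 + c) = h + c * g * h by field; rewrite gt_eqF.
have -> : g * h * h^-1 = g by field; rewrite gt_eqF.
rewrite -(ler_pM2l g0).
have := mulr_ge0 (_ : 0 <= g - h) (_ : 0 <= g - h).
rewrite !subr_ge0 => /(_ hg hg).
lra.
Qed.

(** The induction on [step_inv_incr] starts at k = 2, where the inverse of the
    stepsize exceeds 2 c by [step_lt_half]; at k = 1 the recursion gives no
    such bound. *)
Lemma step_rate k : (2 <= k)%N -> gamma k <= c^-1 * k%:R^-1.
Proof.
move=> k2; have g0 := step_gt0 (ltnW k2).
have kR0 : 0 < k%:R :> R by rewrite ltr0n (ltn_trans _ k2).
rewrite -invfM -[leLHS]invrK lef_pV2 ?posrE ?mulr_gt0 ?invr_gt0//.
elim: k k2 {g0 kR0} => // -[|k]// IH _.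
case: k IH => [|k] IH.
  have g2 := step_gt0 (isT : (1 <= 2)%N).
  rewrite -(ler_pM2r g2) mulVf ?gt_eqF//.
  by have := step_lt_half (isT : (2 <= 2)%N); lra.
apply: le_trans (step_inv_incr _) => //.
by have := IH isT; rewrite -[k.+3%:R]natr1; lra.
Qed.

Lemma step_bigO (f : nat -> R) (C : R) :
  (forall k, (2 <= k)%N -> `|f k| <= C * gamma k ^+ 2) ->
  f =O_\oo (fun k : nat => k%:R ^- 2 : R).
Proof.
move=> fC; apply/eqO_exP; exists ((`|C| + 1) * c^-1 ^+ 2).
  by rewrite mulr_gt0 ?exprn_gt0 ?invr_gt0// ltr_wpDl.
exists 2%N => // k /= k2.
apply: (le_trans (fC k k2)).
rewrite (ger0_norm (_ : 0 <= k%:R ^- 2)) ?invr_ge0 ?exprn_ge0//.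
rewrite -mulrA -exprVn -exprMn.
apply: (@le_trans _ _ ((`|C| + 1) * gamma k ^+ 2)).
  rewrite ler_wpM2r ?sqr_ge0//.
  by rewrite (le_trans (ler_norm C))// lerDl.
have g0 := step_gt0 (ltnW k2).
rewrite ler_wpM2l ?addr_ge0//.
apply: (lerXn2r 2 _ _ (step_rate k2)); rewrite nnegrE ?(ltW g0)//.
by rewrite mulr_ge0 ?invr_ge0 ?(ltW c_gt0).
Qed.

End StepSizes.

(** * Optimality, and the Lyapunov inequality of the algorithm *)

Section Problem.
Context {R : realType} {M : nat} {X : euclideanType R}.
Context {U : 'I_M -> euclideanType R}.
Variables (K : forall m, {linear X -> U m}) (Kadj : forall m, {linear U m -> X}).
Hypothesis K_adjoint : forall m (x : X) (v : U m),
  inner (K m x) v = inner x (Kadj m v).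
Variables (Rg : X -> \bar R) (H : forall m, U m -> \bar R).
Arguments H : clear implicits.
Hypothesis Rg_pcc : proper_closed_convex Rg.
Hypothesis H_pcc : forall m, proper_closed_convex (H m).
Variables (F : 'I_M -> X -> R) (gF : 'I_M -> X -> X) (muF : 'I_M -> R).
Hypothesis F_tangent : forall m x y,
  F m x + inner (gF m x) (y - x) + muF m / 2 * `|y - x| ^+ 2 <= F m y.
Variables (omega : 'I_M -> R) (muhat : R).
Hypothesis M_gt0 : (0 < M)%N.
Hypothesis omega_gt0 : forall m, 0 < omega m.
Hypothesis omega_sum : \sum_(m < M) omega m = 1.
Hypothesis muhat_gt0 : 0 < muhat.
Hypothesis muhat_le : forall m, muhat * (M%:R * omega m) <= muF m.

Variables (xs : X) (v : forall m, U m) (r : X).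
Hypothesis v_sub : forall m, subdiff (H m) (K m xs) (v m).
Arguments v_sub : clear implicits.
Hypothesis r_sub : subdiff Rg xs r.
Hypothesis optimality :
  M%:R^-1 *: (\sum_(m < M) (gF m xs + Kadj m (v m))) + r = 0.

Let Psi := objective F H K Rg.

Let MR_gt0 : 0 < M%:R :> R. Proof. by rewrite ltr0n. Qed.

Let H_fin m : H m (K m xs) \is a fin_num.
Proof. by have [Hp _ _] := H_pcc m; exact: subdiff_fin_num Hp (v_sub m). Qed.

Let Rg_fin : Rg xs \is a fin_num.
Proof. by have [Rp _ _] := Rg_pcc; exact: subdiff_fin_num Rp r_sub. Qed.

(** The tangent inequalities of the F_m and the subgradient inequalities of the
    H_m and of R are added; their linear parts cancel by [optimality].  The
    moduli muF m average to at least muhat because the weights sum to 1. *)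
Lemma quadratic_growth :
  exists psi : R, Psi xs = psi%:E /\
    forall y, ((psi + muhat / 2 * `|y - xs| ^+ 2)%:E <= Psi y)%E.
Proof.
pose h m := fine (H m (K m xs)).
have hE m : H m (K m xs) = (h m)%:E by rewrite fineK.
pose rho := fine (Rg xs); have rhoE : Rg xs = rho%:E by rewrite fineK.
exists (M%:R^-1 * (\sum_(m < M) (F m xs + h m)) + rho); split.
  rewrite /Psi /objective rhoE EFinD EFinM -sumEFin.
  by congr (_ * _ + _)%E; apply: eq_bigr => m _; rewrite hE.
move=> y; set d := y - xs.
(* [low m] is the lower model of F m y + H m (K m y) built at xs. *)
pose low m := F m xs + inner (gF m xs) d + muF m / 2 * `|d| ^+ 2
              + (h m + inner (v m) (K m d)).
apply: (@le_trans _ _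
    ((M%:R^-1)%:E * (\sum_(m < M) (low m)%:E) + (rho + inner r d)%:E)%E).
  rewrite sumEFin -EFinM -EFinD lee_fin.
  have -> : M%:R^-1 * (\sum_(m < M) low m) + (rho + inner r d) =
      M%:R^-1 * (\sum_(m < M) (F m xs + h m)) + rho
      + M%:R^-1 * (\sum_(m < M) muF m / 2 * `|d| ^+ 2)
      + inner (M%:R^-1 *: (\sum_(m < M) (gF m xs + Kadj m (v m))) + r) d.
    rewrite innerDl innerZl (innerC (\sum_(_ < _) _)) inner_sumr.
    have -> : \sum_(m < M) low m =
        \sum_(m < M) (F m xs + h m) + \sum_(m < M) muF m / 2 * `|d| ^+ 2
        + \sum_(m < M) inner d (gF m xs + Kadj m (v m)).
      rewrite -!big_split /=; apply: eq_bigr => m _.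
      by rewrite /low innerDr -K_adjoint (innerC d) (innerC (K m d)); ring.
    ring.
  rewrite optimality inner0l addr0 lerD2l -mulr_suml (mulrA M%:R^-1) ler_wpM2r ?sqr_ge0//.
  rewrite -mulr_suml mulrA (mulrC M%:R^-1) ler_wpM2r// ler_pdivlMr//.
  have -> : muhat * M%:R = \sum_(m < M) muhat * (M%:R * omega m).
    by rewrite -mulr_sumr -mulr_sumr omega_sum mulr1.
  exact: ler_sum.
rewrite /Psi /objective; apply: leeD; last first.
  by rewrite EFinD -rhoE; exact: r_sub.
rewrite lee_wpmul2l// ?lee_fin ?invr_ge0//.
apply: lee_sum => m _; rewrite /low EFinD; apply: leeD.
  by rewrite lee_fin F_tangent.
rewrite EFinD -hE linearB; exact: v_sub.
Qed.

Lemma argmin_unique :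
  is_argmin Psi xs /\ forall y, is_argmin Psi y -> y = xs.
Proof.
have [psi [psiE grow]] := quadratic_growth; split => y.
  rewrite psiE; apply: le_trans (grow y); rewrite lee_fin lerDl.
  by rewrite mulr_ge0 ?sqr_ge0// divr_ge0// ltW.
move=> /(_ xs); rewrite psiE => /(le_trans (grow y)); rewrite lee_fin.
rewrite -[leRHS]addr0 lerD2l pmulr_rle0 ?divr_gt0// => n0.
apply/eqP; rewrite -subr_eq0 -normr_eq0 -sqrf_eq0.
by rewrite eq_le n0 sqr_ge0.
Qed.

Lemma gradient_strongly_monotone m x y :
  muF m * `|x - y| ^+ 2 <= inner (gF m x - gF m y) (x - y).
Proof.
have := F_tangent m x y; have := F_tangent m y x.
rewrite (distrC y) -(opprB x y) innerNr innerBl; lra.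
Qed.

Variables (LF : 'I_M -> R) (kappa eta Lhat : R) (gamma : nat -> R).
Variables (xR : nat -> X) (u : forall m, nat -> U m).
Variables (p x a : 'I_M -> nat -> X).
Hypothesis LF_gt0 : forall m, 0 < LF m.
Hypothesis gF_cocoercive : forall m y z,
  `|gF m y - gF m z| ^+ 2 <= LF m * inner (gF m y - gF m z) (y - z).
Hypothesis Lhat_ge : forall m, LF m <= Lhat * (M%:R * omega m).
Hypothesis kappa_gt0 : 0 < kappa.
Hypothesis eta_gt0 : 0 < eta.
Hypothesis Kadj_le : forall m w, `|Kadj m w| ^+ 2 <= eta * `|w| ^+ 2.
Arguments Kadj_le : clear implicits.
Hypothesis iterates : is_distributed_PDDY gF H K Kadj Rg omega gamma eta xR u p x a.

Let w m : R := M%:R * omega m.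
Let w_gt0 m : 0 < w m. Proof. by rewrite mulr_gt0. Qed.

Lemma dual_monotone m k : 0 < gamma k ->
  0 <= inner ((gamma k / w m) * eta *: (u m k - u m k.+1)) (u m k.+1 - v m)
       + inner (xR k - xs) (Kadj m (u m k.+1 - v m)).
Proof.
move=> g0; have [Hp _ _] := H_pcc m; have [_ proxu _ _ _] := iterates.
have c0 : 0 < w m / (gamma k * eta) by rewrite divr_gt0// mulr_gt0.
have := is_prox_monotone c0 (conjugate_neq_ninfty Hp) (conjugate_convex Hp)
  (proxu m k) (conjugate_subdiff Hp (v_sub m))
  (conjugate_fin_num Hp (v_sub m)).
rewrite -/(w m) -K_adjoint.
set c := w m / _; set du := _ - v m.
have -> : u m k + c *: K m (xR k) - u m k.+1 - c *: K m xs =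
    c *: ((gamma k / w m * eta) *: (u m k - u m k.+1) + K m (xR k - xs)).
  rewrite scalerDr scalerA (linearB (K m)) (scalerBr c (K m _)).
  have -> : c * (gamma k / w m * eta) = 1 by rewrite /c; field; rewrite !gt_eqF.
  by rewrite scale1r !addrA (addrAC (u m k)).
by rewrite innerZl innerDl pmulr_rge0.
Qed.

(** The factor eta / w m ^+ 2 makes gamma^2 times this sum the weighted sum of
    the dual terms of [worker_step] with tau = gamma / w m. *)
Definition dual_dist k : R :=
  \sum_(m < M) omega m * (eta / w m ^+ 2 * `|u m k - v m| ^+ 2).

(** The vector e of [worker_step] for the worker m.  A single proximal step on
    R serves all the workers, so that only the omega-weighted sum of these
    vectors is the difference of a subgradient of R at the server point and of
    the one at xs, times the stepsize. *)
Let err m k := x m k.+1 - xs - (xR k.+1 - xs)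
  - (gamma k.+1 / w m) *: ((gF m (x m k.+1) - gF m xs) + Kadj m (u m k.+1 - v m)).

Lemma primal_monotone k : 0 < gamma k.+1 ->
  0 <= \sum_(m < M) omega m * inner (xR k.+1 - xs) (err m k).
Proof.
move=> g0; have [[Rny _] _ Rcvx] := Rg_pcc; have [pE _ _ aE proxR] := iterates.
have := is_prox_monotone g0 Rny Rcvx (proxR k) r_sub Rg_fin.
rewrite innerC.
suff -> : M%:R^-1 *: (\sum_(m < M) a m k) - xR k.+1 - gamma k.+1 *: r =
    \sum_(m < M) omega m *: err m k.
  by rewrite inner_sumr; under eq_bigr => m _ do rewrite innerZr.
have -> : r = - (M%:R^-1 *: (\sum_(m < M) (gF m xs + Kadj m (v m)))).
  by apply/eqP; rewrite -addr_eq0 addrC optimality.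
have {1}-> : xR k.+1 = \sum_(m < M) omega m *: xR k.+1.
  by rewrite -scaler_suml omega_sum scale1r.
rewrite scalerN opprK.
rewrite scalerA !scaler_sumr -sumrB -big_split /=; apply: eq_bigr => m _.
rewrite /err aE pE (linearB (Kadj m)) -/(w m).
have wE : w m = M%:R * omega m by [].
apply: inner_inj => z; rewrite !innerE wE; field.
by rewrite !gt_eqF.
Qed.

(** Each worker contributes [worker_step] with tau = gamma / w m, the weights
    omega m being those for which the terms in [err] add up to
    [primal_monotone].  The scaling of the constants gives
    tau * LF m <= gamma * Lhat and gamma * muhat <= tau * muF m. *)
Lemma lyapunov_decrease k : 0 < gamma k.+1 ->
  gamma k.+1 * Lhat <= 2 * (1 - kappa) ->
  \sum_(m < M) omega m * `|x m k.+2 - xs| ^+ 2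
  + gamma k.+1 ^+ 2 * dual_dist k.+2 <=
  (1 - 2 * (muhat * kappa) * gamma k.+1) *
    (\sum_(m < M) omega m * `|x m k.+1 - xs| ^+ 2)
  + gamma k.+1 ^+ 2 * dual_dist k.+1.
Proof.
move=> g0 gL; have [pE _ xE _ _] := iterates.
pose before m := (1 - 2 * (muhat * kappa) * gamma k.+1) * `|x m k.+1 - xs| ^+ 2
  + gamma k.+1 ^+ 2 * (eta / w m ^+ 2 * `|u m k.+1 - v m| ^+ 2)
  - 2 * inner (xR k.+1 - xs) (err m k).
have step m : `|x m k.+2 - xs| ^+ 2
    + gamma k.+1 ^+ 2 * (eta / w m ^+ 2 * `|u m k.+2 - v m| ^+ 2) <= before m.
  pose tau := gamma k.+1 / w m.
  have tau0 : 0 < tau by rewrite divr_gt0.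
  have xxE : x m k.+2 - xs =
      (xR k.+1 - xs) - tau *: Kadj m ((u m k.+2 - v m) - (u m k.+1 - v m)).
    rewrite xE !pE -linearB -/tau opprB addrA subrK.
    by rewrite addrAC.
  have dE : x m k.+1 - xs = (xR k.+1 - xs)
      + tau *: ((gF m (x m k.+1) - gF m xs) + Kadj m (u m k.+1 - v m))
      + err m k.
    by rewrite /err -/tau addrAC -addrA subrK subrKC.
  have dual := dual_monotone m g0.
  have dual' : 0 <= inner (tau * eta *: ((u m k.+1 - v m) - (u m k.+2 - v m)))
       (u m k.+2 - v m) + inner (xR k.+1 - xs) (Kadj m (u m k.+2 - v m)).
    by rewrite opprB addrA subrK.
  have := worker_step (ltW tau0) (Kadj_le m) dual' dE.
  rewrite -xxE.
  have tauL : tau * LF m <= 2 * (1 - kappa).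
    apply: le_trans gL; rewrite /tau -mulrA ler_pM2l// mulrC ler_pdivrMr//.
  have tmu : gamma k.+1 * muhat <= tau * muF m.
    by rewrite /tau -mulrA ler_pM2l// mulrC ler_pdivlMr// muhat_le.
  have muF0 : 0 <= muF m.
    by apply: le_trans (muhat_le m); rewrite mulr_ge0 ?ltW// -/(w m).
  have := smooth_strongly_monotone_step (ltW tau0) tauL (ltW kappa_gt0) muF0
     (gF_cocoercive m (x m k.+1) xs)
     (gradient_strongly_monotone m (x m k.+1) xs).
  have := ler_wpM2r (sqr_ge0 `|x m k.+1 - xs|)
     (ler_wpM2l (ltW kappa_gt0) tmu).
  have -> : tau ^+ 2 * eta = gamma k.+1 ^+ 2 * (eta / w m ^+ 2).
    by rewrite /tau expr_div_n mulrAC mulrA.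
  rewrite /before; lra.
rewrite /dual_dist.
have -> : \sum_(m < M) omega m * `|x m k.+2 - xs| ^+ 2 + gamma k.+1 ^+ 2 *
      \sum_(m < M) omega m * (eta / w m ^+ 2 * `|u m k.+2 - v m| ^+ 2) =
    \sum_(m < M) omega m * (`|x m k.+2 - xs| ^+ 2
      + gamma k.+1 ^+ 2 * (eta / w m ^+ 2 * `|u m k.+2 - v m| ^+ 2)).
  by rewrite mulr_sumr -big_split /=; apply: eq_bigr => m _; ring.
apply: (@le_trans _ _ (\sum_(m < M) omega m * before m)).
  by apply: ler_sum => m _; exact: (ler_wpM2l (ltW (omega_gt0 m)) (step m)).
have -> : \sum_(m < M) omega m * before m =
    (1 - 2 * (muhat * kappa) * gamma k.+1) *
      (\sum_(m < M) omega m * `|x m k.+1 - xs| ^+ 2)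
    + gamma k.+1 ^+ 2 *
      (\sum_(m < M) omega m * (eta / w m ^+ 2 * `|u m k.+1 - v m| ^+ 2))
    - 2 * \sum_(m < M) omega m * inner (xR k.+1 - xs) (err m k).
  rewrite !mulr_sumr -big_split -sumrB /=.
  by apply: eq_bigr => m _; rewrite /before; ring.
by rewrite gerBl mulr_ge0// primal_monotone.
Qed.

Let c := muhat * kappa.
Hypothesis gamma1_gt0 : 0 < gamma 1.
Hypothesis gamma1_le : gamma 1 * Lhat <= 2 * (1 - kappa).
Hypothesis gammaS : forall k, (1 <= k)%N ->
  gamma k.+1 = - gamma k ^+ 2 * c + gamma k * Num.sqrt ((gamma k * c) ^+ 2 + 1).

Let c_gt0 : 0 < c. Proof. exact: mulr_gt0. Qed.
Let gamma_gt0 := step_gt0 c_gt0 gamma1_gt0 gammaS.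

Definition primal_dist k : R := \sum_(m < M) omega m * `|x m k - xs| ^+ 2.

(** The primal distance at k + 1 is divided by the stepsize of index k: this
    stepsize is the one used in the step from xR k to x m k.+1. *)
Let potential k := primal_dist k.+1 / gamma k ^+ 2 + dual_dist k.+1.

(** [lyapunov_decrease] divided by gamma_{k+1}^2, with [step_recurrence]. *)
Lemma potential_decr k : (1 <= k)%N -> potential k.+1 <= potential k.
Proof.
move=> k1; have g0 := gamma_gt0 k1; have g1 := gamma_gt0 (leqW k1).
have Lhat0 : 0 <= Lhat.
  have m := Ordinal M_gt0.
  by rewrite -(pmulr_lge0 _ (w_gt0 m)) (le_trans (ltW (LF_gt0 m))).
have gL : gamma k.+1 * Lhat <= 2 * (1 - kappa).
  apply: le_trans gamma1_le; rewrite ler_wpM2r//.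
  exact: (step_le1 c_gt0 gamma1_gt0 gammaS).
have := lyapunov_decrease g1 gL.
have rec := step_recurrence gammaS k1.
have g20 : 0 < gamma k.+1 ^+ 2 by rewrite exprn_gt0.
rewrite -/(primal_dist _) -/(primal_dist _) -/c => dec.
rewrite /potential -(ler_pM2l g20) !mulrDr.
rewrite [in leLHS]mulrCA divff ?gt_eqF// mulr1.
apply: (le_trans dec); rewrite lerD2r le_eqVlt; apply/orP; left; apply/eqP.
by rewrite rec; field; rewrite gt_eqF.
Qed.

Lemma potential_le1 k : (1 <= k)%N -> potential k <= potential 1.
Proof.
elim: k => // -[|k] IH _ //.
exact: le_trans (potential_decr (ltn0Sn k)) (IH isT).
Qed.

Let sum_term_le (f : 'I_M -> R) m :
  (forall i, 0 <= f i) -> f m <= \sum_(i < M) f i.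
Proof. by move=> f0; rewrite (bigD1 m)//= lerDl sumr_ge0. Qed.

Lemma primal_dist_term m k : `|x m k - xs| ^+ 2 <= (omega m)^-1 * primal_dist k.
Proof.
rewrite [leRHS]mulrC ler_pdivlMr// mulrC.
apply: (@sum_term_le (fun m => omega m * `|x m k - xs| ^+ 2)) => i.
by rewrite mulr_ge0 ?sqr_ge0 ?ltW.
Qed.

Let dual_term_ge0 m k : 0 <= omega m * (eta / w m ^+ 2 * `|u m k - v m| ^+ 2).
Proof.
by rewrite !mulr_ge0 ?invr_ge0 ?sqr_ge0 ?(ltW (omega_gt0 m)) ?(ltW eta_gt0).
Qed.

Lemma dual_dist_term m k :
  eta / w m ^+ 2 * `|u m k - v m| ^+ 2 <= (omega m)^-1 * dual_dist k.
Proof.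
rewrite [leRHS]mulrC ler_pdivlMr// mulrC.
exact: (@sum_term_le
  (fun m => omega m * (eta / w m ^+ 2 * `|u m k - v m| ^+ 2))).
Qed.

Lemma primal_dist_ge0 k : 0 <= primal_dist k.
Proof. by rewrite sumr_ge0// => m _; rewrite mulr_ge0 ?sqr_ge0 ?ltW. Qed.

Lemma dual_dist_ge0 k : 0 <= dual_dist k.
Proof. by rewrite sumr_ge0. Qed.

Lemma distance_bounds : exists2 C, 0 <= C & forall k, (1 <= k)%N ->
  primal_dist k.+1 <= gamma k ^+ 2 * C /\ dual_dist k.+1 <= C.
Proof.
have pd0 k : 0 <= primal_dist k.+1 / gamma k ^+ 2.
  by rewrite divr_ge0 ?primal_dist_ge0 ?sqr_ge0.
exists (potential 1) => [|k k1]; first by rewrite addr_ge0 ?dual_dist_ge0.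
have g0 := exprn_gt0 2 (gamma_gt0 k1); have := potential_le1 k1.
have := pd0 k; have := dual_dist_ge0 k.+1; rewrite /potential => d0 p0 le.
split; last by lra.
rewrite mulrC -ler_pdivrMr//; lra.
Qed.

Let rho := 1 + 2 * c * gamma 1.

(** The potential bounds primal_dist k by a multiple of gamma_{k-1}^2; the
    factor rho shifts the index of the stepsize. *)
Lemma primal_dist_le : exists2 C, 0 <= C & forall k, (2 <= k)%N ->
  primal_dist k <= C * gamma k ^+ 2.
Proof.
have [C C0 CP] := distance_bounds.
exists (rho ^+ 2 * C) => [|[|[|k]]// _]; first by rewrite mulr_ge0 ?sqr_ge0.
have [le _] := CP _ (ltn0Sn k); apply: (le_trans le).
rewrite mulrC [leRHS]mulrAC -exprMn mulrC ler_wpM2r//.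
rewrite lerXn2r ?nnegrE ?(ltW (gamma_gt0 (ltn0Sn k)))//.
  by rewrite mulr_ge0 ?(ltW (gamma_gt0 (ltn0Sn k.+1)))// addr_ge0 ?mulr_ge0 ?ltW.
exact: (step_ratio c_gt0 gamma1_gt0 gammaS).
Qed.

Lemma worker_rate m : exists C, forall k, (2 <= k)%N ->
  `|x m k - xs| ^+ 2 <= C * gamma k ^+ 2.
Proof.
have [C _ CP] := primal_dist_le; exists ((omega m)^-1 * C) => k k2.
apply: (le_trans (primal_dist_term m k)).
by rewrite -mulrA ler_wpM2l ?CP// invr_ge0 ltW.
Qed.

(** The server point differs from any worker point by tau *: dp, where dp is the
    image of a dual increment, and the dual distances are bounded, so that this
    difference is of the order of the stepsize. *)
Lemma server_rate : exists C, forall k, (2 <= k)%N ->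
  `|xR k - xs| ^+ 2 <= C * gamma k ^+ 2.
Proof.
have [pE _ xE _ _] := iterates.
have [C C0 CP] := distance_bounds; have m := Ordinal M_gt0.
(* 10 = 2 * (1 + 4): the parallelogram bound [sqr_norm_subD] is used once for
   the server point and once for the dual increment, whose two terms are each
   at most C / omega m. *)
exists (10 * (omega m)^-1 * C) => -[|[|k]]// _.
have [xle ule'] := CP k.+2 isT; have [_ ule] := CP k.+1 isT.
have oV0 : 0 <= (omega m)^-1 by rewrite invr_ge0 ltW.
have := ler_wpM2l oV0 ule; have := ler_wpM2l oV0 ule'.
move=> /(le_trans (dual_dist_term m _)) d' /(le_trans (dual_dist_term m _)) d.
have x' := le_trans (primal_dist_term m k.+3) (ler_wpM2l oV0 xle).
pose tau := gamma k.+2 / w m.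
pose dp := Kadj m ((u m k.+3 - v m) - (u m k.+2 - v m)).
have -> : xR k.+2 - xs = (x m k.+3 - xs) - (- (tau *: dp)).
  rewrite xE !pE -linearB -/(w m) -/tau /dp opprB addrA subrK opprK.
  by rewrite addrAC subrK.
apply: (le_trans (sqr_norm_subD _ _)).
rewrite normrN normrZ exprMn real_normK ?num_real//.
have dple := le_trans (Kadj_le m _ : `|dp| ^+ 2 <= _)
  (ler_wpM2l (ltW eta_gt0) (sqr_norm_subD _ _)).
have := ler_wpM2l (sqr_ge0 tau) dple.
have := ler_wpM2l (sqr_ge0 (gamma k.+2)) (lerD d d').
rewrite /tau expr_div_n.
lra.
Qed.

End Problem.

(** * The convergence rate *)

Theorem theorem10 (R : realType) (M : nat) (M_gt0 : (0 < M)%N)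
    (X : euclideanType R) (U : 'I_M -> euclideanType R)
    (K : forall m, {linear X -> U m}) (Kadj : forall m, {linear U m -> X})
    (K_adjoint : forall m (x : X) (v : U m),
        inner (K m x) v = inner x (Kadj m v))
    (Rg : X -> \bar R) (H : forall m, U m -> \bar R)
    (Rg_pcc : proper_closed_convex Rg)
    (H_pcc : forall m, proper_closed_convex (H m))
    (F : 'I_M -> X -> R) (gF : 'I_M -> X -> X) (LF muF : 'I_M -> R)
    (F_convex : forall m, convex_function [set: X] (F m))
    (F_grad : forall m (x : X), is_diff x (F m) (inner (gF m x)))
    (LF_gt0 : forall m, 0 < LF m)
    (gF_lipschitz : forall m, (LF m).-lipschitz (gF m))
    (muF_ge0 : forall m, 0 <= muF m)
    (F_strongly_convex : forall m,
        convex_function [set: X] (fun x : X => F m x - muF m / 2 * `|x| ^+ 2))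
    (omega : 'I_M -> R)
    (omega_gt0 : forall m, 0 < omega m)
    (omega_sum : \sum_(m < M) omega m = 1)
    (standing : exists x : X, zero_inclusion gF H K Kadj Rg x)
    (kappa eta Knorm2 : R) (gamma : nat -> R)
    (xR : nat -> X) (u : forall m, nat -> U m) (p x a : 'I_M -> nat -> X) :
  let Psi := objective F H K Rg in
  let LFhat := max_ord M_gt0 (fun m => LF m / (M%:R * omega m)) in
  let muFhat := min_ord M_gt0 (fun m => muF m / (M%:R * omega m)) in
  0 < muFhat ->
  0 < kappa < 1 ->
  0 < gamma 0%N < 2 * (1 - kappa) / LFhat ->
  gamma 1%N = gamma 0%N ->
  (forall k : nat, (1 <= k)%N ->
     gamma k.+1 = - gamma k ^+ 2 * muFhat * kappa
                  + gamma k * Num.sqrt ((gamma k * muFhat * kappa) ^+ 2 + 1)) ->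
  0 < eta ->
  (Knorm2 = max_ord M_gt0 (fun m => opnorm (K m) ^+ 2) \/
   (forall m (z : X), F m z = 0) /\
   Knorm2 = opnorm (fun z : X => \sum_(m < M) omega m *: Kadj m (K m z))) ->
  Knorm2 <= eta ->
  is_distributed_PDDY gF H K Kadj Rg omega gamma eta xR u p x a ->
  exists xstar : X,
    [/\ is_argmin Psi xstar /\
          (forall y : X, is_argmin Psi y -> y = xstar),
        exists c0 : R,
          [/\ 0 < c0,
              forall k : nat, (1 <= k)%N ->
                \sum_(m < M) omega m * `|x m k.+1 - xstar| ^+ 2
                <= gamma k.+1 ^+ 2 / (1 - gamma k.+1 * muFhat * kappa) * c0 &
              (fun k : nat =>
                 gamma k.+1 ^+ 2 / (1 - gamma k.+1 * muFhat * kappa) * c0)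
              =O_\oo (fun k : nat => k%:R ^- 2 : R)],
        forall m, (fun k : nat => `|x m k - xstar| ^+ 2)
                  =O_\oo (fun k : nat => k%:R ^- 2 : R) &
        Knorm2 < eta ->
          (fun k : nat => `|xR k - xstar| ^+ 2)
          =O_\oo (fun k : nat => k%:R ^- 2 : R)].
Proof.
move=> Psi LFhat muFhat mu_gt0 /andP[k_gt0 k_lt1] /andP[g0_gt0 g0_lt] g1E grec.
move=> eta_gt0 KnormE Knorm_le iter.
have [xs [v [r [v_sub r_sub opt]]]] := standing.
have MR_gt0 : 0 < M%:R :> R by rewrite ltr0n.
have w_gt0 m : 0 < M%:R * omega m by rewrite mulr_gt0.
have LF_le m : LF m <= LFhat * (M%:R * omega m).
  by rewrite -ler_pdivrMr//; exact: le_bigmax.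
have mu_le m : muFhat * (M%:R * omega m) <= muF m.
  by rewrite -ler_pdivlMr//; exact: bigmin_le.
have tangent m y z :
    F m y + inner (gF m y) (z - y) + muF m / 2 * `|z - y| ^+ 2 <= F m z.
  exact: strongly_convex_gradient (F_grad m y) (F_strongly_convex m).
have coc m y z :
    `|gF m y - gF m z| ^+ 2 <= LF m * inner (gF m y - gF m z) (y - z).
  apply: cocoercive (LF_gt0 m) _ _ y z => y z.
    apply: le_trans (tangent m y z); rewrite lerDl mulr_ge0 ?sqr_ge0//.
    by rewrite divr_ge0.
  by have := gF_lipschitz m (y, z); apply.
have Kadj_le m (w : U m) : `|Kadj m w| ^+ 2 <= eta * `|w| ^+ 2.
  case: KnormE => [E|[F0 _]].
    apply: (le_trans (le_opnorm_adjoint (K_adjoint m) w)).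
    rewrite ler_wpM2r ?sqr_ge0//; apply: le_trans Knorm_le.
    by rewrite E; exact: (@le_bigmax _ _ _ _ (fun m => opnorm (K m) ^+ 2)).
  (* F = 0 is strongly convex: every vector of the form Kadj m w vanishes. *)
  have muF_gt0 : 0 < muF m by apply: lt_le_trans (mu_le m); rewrite mulr_gt0.
  have := tangent m 0 (Kadj m w); have := tangent m 0 (- Kadj m w).
  rewrite !F0 !subr0 innerNr normrN => t1 t2.
  have /eqP -> : `|Kadj m w| ^+ 2 == 0.
    by rewrite eq_le sqr_ge0 andbT -(pmulr_rle0 _ muF_gt0); lra.
  by rewrite mulr_ge0 ?sqr_ge0 ?ltW.
have LF_pos : 0 < LFhat.
  have m := Ordinal M_gt0.
  by rewrite -(pmulr_lgt0 _ (w_gt0 m)) (lt_le_trans (LF_gt0 m)).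
have c_gt0 : 0 < muFhat * kappa by rewrite mulr_gt0.
have g1_gt0 : 0 < gamma 1 by rewrite g1E.
have g1_le : gamma 1 * LFhat <= 2 * (1 - kappa).
  by rewrite g1E -ler_pdivlMr// ltW.
have grec' k : (1 <= k)%N -> gamma k.+1 = - gamma k ^+ 2 * (muFhat * kappa)
    + gamma k * Num.sqrt ((gamma k * (muFhat * kappa)) ^+ 2 + 1).
  by move=> k1; rewrite grec// !(mulrA _ muFhat kappa).
exists xs; split.
- exact: (argmin_unique K_adjoint Rg_pcc H_pcc tangent M_gt0 omega_sum mu_gt0
    mu_le v_sub r_sub opt).
- have [C C0 CP] := primal_dist_le K_adjoint Rg_pcc H_pcc tangent M_gt0 omega_gt0
    omega_sum mu_gt0 mu_le v_sub r_sub opt LF_gt0 coc LF_le k_gt0 eta_gt0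
    Kadj_le iter g1_gt0 g1_le grec'.
  have pos k : (1 <= k)%N -> 1 / 2 <= 1 - gamma k.+1 * muFhat * kappa < 1.
    move=> k1; have := step_lt_half c_gt0 g1_gt0 grec' (k1 : (2 <= k.+1)%N).
    have := mulr_gt0 (step_gt0 c_gt0 g1_gt0 grec' (leqW k1)) c_gt0.
    by rewrite mulrA => ? ?; apply/andP; split; lra.
  (* C may be 0, whereas the constant has to be positive. *)
  exists (C + 1); split; first by rewrite ltr_wpDl.
    move=> k k1; apply: (le_trans (CP k.+1 k1)).
    have /andP[lo hi] := pos k k1.
    have d_gt0 : 0 < 1 - gamma k.+1 * muFhat * kappa by lra.
    rewrite mulrAC ler_pdivlMr// mulrC.
    have := sqr_ge0 (gamma k.+1); have := mulr_ge0 C0 (sqr_ge0 (gamma k.+1)).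
    move: (1 - _) lo hi d_gt0 => d lo hi d_gt0 h1 h2.
    have := ler_wpM2r h1 (ltW hi); lra.
  apply: (step_bigO c_gt0 g1_gt0 grec' (C := 2 * (C + 1))) => k k2.
  have k1 := ltnW k2; have /andP[lo hi] := pos k k1.
  have d_gt0 : 0 < 1 - gamma k.+1 * muFhat * kappa by lra.
  have C1 : 0 <= C + 1 by rewrite addr_ge0.
  rewrite ger0_norm; last by rewrite mulr_ge0// divr_ge0 ?sqr_ge0 ?ltW.
  rewrite (mulrC 2) -(mulrA (C + 1)) (mulrC _ (C + 1)) ler_wpM2l// ler_pdivrMr//.
  have g_le : gamma k.+1 ^+ 2 <= gamma k ^+ 2.
    rewrite lerXn2r ?nnegrE ?(step_decr c_gt0 g1_gt0 grec')//.
      exact/ltW/(step_gt0 c_gt0 g1_gt0 grec' (leqW k1)).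
    exact/ltW/(step_gt0 c_gt0 g1_gt0 grec' k1).
  have := ler_wpM2l (sqr_ge0 (gamma k)) lo; lra.
- move=> m.
  have [C CP] := worker_rate K_adjoint Rg_pcc H_pcc tangent M_gt0 omega_gt0
    omega_sum mu_gt0 mu_le v_sub r_sub opt LF_gt0 coc LF_le k_gt0 eta_gt0
    Kadj_le iter g1_gt0 g1_le grec' m.
  apply: (step_bigO c_gt0 g1_gt0 grec' (C := C)) => k k2.
  by rewrite ger0_norm ?sqr_ge0 ?CP.
- move=> _.
  have [C CP] := server_rate K_adjoint Rg_pcc H_pcc tangent M_gt0 omega_gt0
    omega_sum mu_gt0 mu_le v_sub r_sub opt LF_gt0 coc LF_le k_gt0 eta_gt0
    Kadj_le iter g1_gt0 g1_le grec'.
  apply: (step_bigO c_gt0 g1_gt0 grec' (C := C)) => k k2.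
  by rewrite ger0_norm ?sqr_ge0 ?CP.
Qed.
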